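(* The functions $$R^{a_1,a_2,a_3}_{b_1,b_2,b_3}(\lambda_1,\lambda_2,\lambda_3)=\frac{(-q)^{a_2-b_3}}{(q^2;q^2)_{a_2-b_3}}\,q^{(b_1-b_3+n_{13})(a_2-b_3-n_{23})+n_{13}n_{23}}\,\delta^{a_1+a_2}_{b_1+b_2}\,\delta^{a_2+a_3}_{b_2+b_3},\qquad n_{ij}=\frac{\lambda_i-\lambda_j}{\hbar},$$ of $a_i,b_i\in\mathbb Z$ satisfy the tetrahedron equation: for all $\lambda_1,\dots,\lambda_6\in\mathbb C$ and all $a_i,c_i\in\mathbb Z$ $(i=1,\dots,6)$, $$\sum_{b_1,\dots,b_6\in\mathbb Z}R^{a_1,a_2,a_4}_{b_1,b_2,b_4}(\lambda_1,\lambda_2,\lambda_4)R^{b_1,a_3,a_5}_{c_1,b_3,b_5}(\lambda_1,\lambda_3,\lambda_5)R^{b_2,b_3,a_6}_{c_2,c_3,b_6}(\lambda_2,\lambda_3,\lambda_6)R^{b_4,b_5,b_6}_{c_4,c_5,c_6}(\lambda_4,\lambda_5,\lambda_6)$$ $$=\sum_{b_1,\dots,b_6\in\mathbb Z}R^{a_4,a_5,a_6}_{b_4,b_5,b_6}(\lambda_4,\lambda_5,\lambda_6)R^{a_2,a_3,b_6}_{b_2,b_3,c_6}(\lambda_2,\lambda_3,\lambda_6)R^{a_1,b_3,b_5}_{b_1,c_3,c_5}(\lambda_1,\lambda_3,\lambda_5)R^{b_1,b_2,b_4}_{c_1,c_2,c_4}(\lambda_1,\lambda_2,\lambda_4).$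$
   Context: $\hbar$ is a generic complex parameter, $q=e^\hbar$ (not a root of unity), and $q^{x}=e^{\hbar x}$ for $x\in\mathbb C$. In $R(\lambda_i,\lambda_j,\lambda_k)$ the three arguments play the roles of $\lambda_1,\lambda_2,\lambda_3$ in the defining formula. $\delta^a_b$ is the Kronecker delta. $(z;q)_n=(z;q)_\infty/(zq^n;q)_\infty$ for $n\in\mathbb Z$, with $(z;q)_\infty=\prod_{k\ge0}(1-zq^k)$; in particular $(q^2;q^2)_n=\prod_{k=1}^n(1-q^{2k})$ for $n\ge0$ and $1/(q^2;q^2)_n=0$ for $n<0$. Only finitely many terms in each sum are nonzero. *)

(* Defs.v *)
From HB Require Import structures.
From mathcomp Require Import all_boot all_order all_algebra.
From mathcomp Require Import complex.
From mathcomp Require Import all_classical all_reals all_analysis.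

Set Implicit Arguments.
Unset Strict Implicit.
Unset Printing Implicit Defensive.

Import Order.TTheory GRing.Theory Num.Theory.

Local Open Scope ring_scope.
Local Open Scope complex_scope.

(* exp (x + i y) = e^x (cos y + i sin y), on the complex numbers R[i]. *)
Definition cexp (R : realType) (z : R[i]) : R[i] :=
  (expR (complex.Re z) * cos (complex.Im z)) +i*
  (expR (complex.Re z) * sin (complex.Im z)).

(* (z; p)_n for n in Z: the quotient (z; p)_oo / (z p^n; p)_oo after
   cancellation of the common factors, which makes sense for every p != 0, not
   only when the infinite products converge.
   For n < 0, (p; p)_n is a pole (the factor k = 0 vanishes); as 0^-1 = 0 in
   MathComp, its reciprocal is nevertheless 0, see qpochV_neg. *)
Definition qpoch (F : fieldType) (z p : F) (n : int) : F :=
  match n with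
  | Posz m => \prod_(k < m) (1 - z * p ^+ k)
  | Negz m => (\prod_(k < m.+1) (1 - z / p ^+ k.+1))^-1
  end.

Lemma qpoch_nat (F : fieldType) (p : F) (m : nat) :
  qpoch p p m%:Z = \prod_(1 <= k < m.+1) (1 - p ^+ k).
Proof.
rewrite /= big_add1 /= big_mkord.
by apply: eq_bigr => k _; rewrite exprS.
Qed.

Lemma qpochV_neg (F : fieldType) (p : F) (n : int) :
  p != 0 -> n < 0 -> (qpoch p p n)^-1 = 0.
Proof.
case: n => // m p0 _.
by rewrite /= invrK big_ord_recl /= expr1 divff // subrr mul0r.
Qed.

(* R^{a1,a2,a3}_{b1,b2,b3}(l1,l2,l3), where q = e^hbar and q^x = e^(hbar x). *)
Definition Rmat (R : realType) (hbar l1 l2 l3 : R[i])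
    (a1 a2 a3 b1 b2 b3 : int) : R[i] :=
  let q := cexp hbar in
  let n13 := (l1 - l3) / hbar in
  let n23 := (l2 - l3) / hbar in
  (- q) ^ (a2 - b3) / qpoch (q ^+ 2) (q ^+ 2) (a2 - b3)
  * cexp (hbar * (((b1 - b3)%:~R + n13) * ((a2 - b3)%:~R - n23) + n13 * n23))
  * (a1 + a2 == b1 + b2)%:R * (a2 + a3 == b2 + b3)%:R.

(* Main.v *)
(* Since (b1 - b3 + n13)(m - n23) + n13 n23 = (b1 - b3) m - n23 (b1 - b3) + n13 m,
   the exponent of R is affine in the spectral parameters, and the charge
   conservation of the Kronecker deltas makes the total spectral exponent of each
   side independent of the summation variables.  The deltas leave a single free
   summation index on each side, and up to a common factor the equation reads
     sum_n (-q)^n q^(n^2 + 2(M-N)n) / ((n)! (N-n)! (M)! (n+g)!)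
       = sum_j (-q)^j q^(j^2 + 2gj) / ((M-N+j)! (N+g)! (N-j)! (j)!)
   where (i)! = (q^2;q^2)_i.  By the q-binomial theorem
     1/((i)! (m)!) = 1/(i+m)! sum_j (-q)^j q^(j^2 + 2ij) / ((j)! (m-j)!),
   applied with m = N - n on the left and m = N - j on the right, both sides are
   the same double sum over (n, j). *)

Require Import Defs.
From HB Require Import structures.
From mathcomp Require Import all_boot all_order all_algebra.
From mathcomp Require Import complex.
From mathcomp Require Import all_classical all_reals all_analysis.
From mathcomp Require Import ring zify.

Set Implicit Arguments.
Unset Strict Implicit.
Unset Printing Implicit Defensive.

Import Order.TTheory GRing.Theory Num.Theory.

Local Open Scope classical_set_scope.
Local Open Scope ring_scope.
Local Open Scope complex_scope.

(** * Reciprocal q-Pochhammer symbols and the q-binomial theorem *)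

Definition inv_qpoch (F : fieldType) (q : F) (i : int) : F :=
  (qpoch (q ^+ 2) (q ^+ 2) i)^-1.
Arguments inv_qpoch : simpl never.

Section QSeries.
Variables (F : fieldType) (q : F).
Hypothesis q_neq0 : q != 0.
Hypothesis q_not_root : forall n : nat, (0 < n)%N -> ~~ n.-unity_root q.

Local Notation V := (inv_qpoch q).

Lemma qsqr_exp_neq1 (n : nat) : (0 < n)%N -> 1 - q ^+ 2 ^+ n != 0.
Proof.
move=> n_gt0; rewrite subr_eq0 eq_sym -exprM -unity_rootE.
by apply: q_not_root; rewrite muln_gt0.
Qed.

Lemma inv_qpoch_lt0 (i : int) : i < 0 -> V i = 0.
Proof. by apply: qpochV_neg; rewrite expf_neq0. Qed.

(** For [i > 0] the last factor of the product cancels. At [i = 0] both [V (-1)] and [1 - q ^ 0]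
    vanish, so no boundary case has to be excluded later. *)
Lemma inv_qpoch_rec (i : int) : V (i - 1) = (1 - q ^ (2 * i)) * V i.
Proof.
have [i_lt0|] := ltP i 0; first by rewrite !inv_qpoch_lt0 ?mulr0 //; lia.
case: i => // [[|n]] _; first by rewrite inv_qpoch_lt0 // mulr0 expr0z subrr mul0r.
have -> : n.+1%:Z - 1 = n%:Z by lia.
have -> : q ^ (2 * n.+1%:Z) = q ^+ 2 ^+ n.+1.
  by rewrite -exprM.
rewrite /inv_qpoch /= big_ord_recr /= -exprS invfM mulrCA divff ?mulr1 //.
exact: qsqr_exp_neq1.
Qed.

(** Terms with [j > m] vanish, so every [K > m] gives the full sum; a free [K] allows one common
    range in [tetrahedron_sum]. *)
Let qbin_sum (K : nat) (i m : int) : F :=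
  \sum_(j < K) (- q) ^+ j * q ^ (j%:Z * (j%:Z + 2 * i)) * V j%:Z * V (m - j%:Z).

Lemma qbin_sum_lt0 K i m : m < 0 -> qbin_sum K i m = 0.
Proof.
move=> m_lt0; apply: big1 => j _.
by rewrite (@inv_qpoch_lt0 (m - _)) ?mulr0 //; lia.
Qed.

Lemma qbin_sum_rec (K : nat) (i m : int) : m <= K%:Z ->
  (1 - q ^ (2 * m)) * qbin_sum K.+1 i m =
  (1 - q ^ (2 * (i + m))) * qbin_sum K.+1 i (m - 1).
Proof.
move=> m_le.
(* 1 - q^2m = (1 - q^2(m-j)) + q^2(m-j) (1 - q^2j), each factor being absorbed
   by a reciprocal Pochhammer symbol. *)
have split_term (j : nat) : (1 - q ^ (2 * m)) *
    ((- q) ^+ j * q ^ (j%:Z * (j%:Z + 2 * i)) * V j%:Z * V (m - j%:Z)) =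
  (- q) ^+ j * q ^ (j%:Z * (j%:Z + 2 * i)) * V j%:Z * V (m - 1 - j%:Z) +
  (- q) ^+ j * q ^ (j%:Z * (j%:Z + 2 * i) + 2 * (m - j%:Z)) *
     V (j%:Z - 1) * V (m - j%:Z).
  have -> : m - 1 - j%:Z = (m - j%:Z) - 1 by lia.
  rewrite !inv_qpoch_rec.
  have -> : 2 * m = 2 * j%:Z + 2 * (m - j%:Z) by lia.
  rewrite !expfzDr //; ring.
rewrite mulr_sumr; under eq_bigr => j _ do rewrite split_term.
rewrite big_split /= mulrBl mul1r; congr (_ + _).
(* The term [j = 0] drops out because [V (-1) = 0]. The shift from [j] to [j + 1] yields
   [- q ^ (2 * (i + m))] times the sum for [m - 1], whose term [j = K] vanishes as [m - 1 < K]. *)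
rewrite big_ord_recl [V (_ - 1)]inv_qpoch_lt0 // mulr0 mul0r add0r.
rewrite [qbin_sum K.+1 _ _]big_ord_recr /=.
rewrite (@inv_qpoch_lt0 (m - 1 - _)) ?mulr0 ?addr0; last by lia.
rewrite -mulNr mulr_sumr; apply: eq_bigr => j _ /=.
rewrite /bump /= add1n exprS.
have -> : j.+1%:Z - 1 = j%:Z by lia.
have -> : m - j.+1%:Z = m - 1 - j%:Z by lia.
have -> : j.+1%:Z * (j.+1%:Z + 2 * i) + 2 * (m - 1 - j%:Z) =
  j%:Z * (j%:Z + 2 * i) + 2 * (i + m) - 1.
  have -> : j.+1%:Z = j%:Z + 1 by lia.
  ring.
rewrite (expfzDr _ _ q_neq0) (expfzDr _ (2 * (i + m)) q_neq0).
by rewrite exprN1; field.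
Qed.

(** Induction on [m]: multiplied by [1 - q ^ (2 * m)], each side becomes its value at [m - 1]. On
    the right, the factor [1 - q ^ (2 * (i + m))] from [qbin_sum_rec] is absorbed by [V (i + m)]. *)
Lemma inv_qpoch_mul (K : nat) (i m : int) : m <= K%:Z ->
  V i * V m = V (i + m) * qbin_sum K.+1 i m.
Proof.
move=> m_le; have [m_lt0|] := ltP m 0.
  by rewrite qbin_sum_lt0 // (inv_qpoch_lt0 m_lt0) !mulr0.
case: m m_le => // n; elim: n => [_|n IH n_le] _.
  rewrite addr0 /qbin_sum big_ord_recl big1 ?addr0 => [|j _].
    by rewrite mul0r /inv_qpoch /= big_ord0 invr1 !mulr1.
  by rewrite (@inv_qpoch_lt0 (_ - _)) ?mulr0 // /bump /=; lia.
have nz : 1 - q ^ (2 * n.+1%:Z) != 0.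
  by have := @qsqr_exp_neq1 n.+1 isT; rewrite -exprM.
apply: (mulfI nz); rewrite !(mulrCA (1 - _)) qbin_sum_rec // -inv_qpoch_rec.
have -> : n.+1%:Z - 1 = n%:Z by lia.
rewrite IH //; last by lia.
rewrite mulrA [_ * (1 - _)]mulrC -inv_qpoch_rec.
by congr (V _ * _); lia.
Qed.

Lemma tetrahedron_sum (K : nat) (N M g : int) : N <= K%:Z ->
  \sum_(n < K.+1) (- q) ^+ n * q ^ (n%:Z * (n%:Z + 2 * (M - N))) *
     (V n%:Z * V (N - n%:Z) * V M * V (n%:Z + g)) =
  \sum_(j < K.+1) (- q) ^+ j * q ^ (j%:Z * (j%:Z + 2 * g)) *
     (V (M - N + j%:Z) * V (N + g) * V (N - j%:Z) * V j%:Z).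
Proof.
move=> N_le.
transitivity (\sum_(n < K.+1) \sum_(j < K.+1) (- q) ^+ n * (- q) ^+ j *
  q ^ (n%:Z * (n%:Z + 2 * (M - N)) + j%:Z * (j%:Z + 2 * (n%:Z + g))) *
  (V n%:Z * V j%:Z * V M * V (N + g) * V (N - n%:Z - j%:Z))).
  apply: eq_bigr => n _.
  have E : V (n%:Z + g) * V (N - n%:Z) =
      V (N + g) * qbin_sum K.+1 (n%:Z + g) (N - n%:Z).
    have -> : N + g = n%:Z + g + (N - n%:Z) by ring.
    by apply: inv_qpoch_mul; lia.
  transitivity ((- q) ^+ n * q ^ (n%:Z * (n%:Z + 2 * (M - N))) * V n%:Z * V M *
    (V (n%:Z + g) * V (N - n%:Z))); first by ring.
  rewrite E /qbin_sum !mulr_sumr.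
  by apply: eq_bigr => j _; rewrite expfzDr //; ring.
rewrite exchange_big /=; apply: eq_bigr => j _.
have E : V (M - N + j%:Z) * V (N - j%:Z) =
    V M * qbin_sum K.+1 (M - N + j%:Z) (N - j%:Z).
  rewrite [in V M](_ : M = M - N + j%:Z + (N - j%:Z)); last by ring.
  by apply: inv_qpoch_mul; lia.
rewrite [V (M - N + _) * _ * _]mulrAC E /qbin_sum mulr_sumr !mulr_suml mulr_sumr.
apply: eq_bigr => n _.
rewrite [N - n%:Z - j%:Z]addrAC.
(* Both expansions produce the same cross term [2 * n * j]. *)
rewrite (_ : n%:Z * (n%:Z + 2 * (M - N)) + _ = j%:Z * (j%:Z + 2 * g) +
  n%:Z * (n%:Z + 2 * (M - N + j%:Z))); last by ring.
by rewrite expfzDr //; ring.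
Qed.

End QSeries.

(** * The complex exponential *)

Lemma cexp0 (R : realType) : cexp 0 = 1 :> R[i].
Proof. by rewrite /cexp /= expR0 cos0 sin0 mulr1 mulr0. Qed.

Lemma cexpD (R : realType) (x y : R[i]) : cexp (x + y) = cexp x * cexp y.
Proof.
case: x y => [x1 x2] [y1 y2]; apply/eqP.
by rewrite eq_complex /cexp /= expRD cosD sinD; apply/andP; split; apply/eqP; ring.
Qed.

Lemma cexp_neq0 (R : realType) (x : R[i]) : cexp x != 0.
Proof.
apply/eqP => x0; have := cexpD x (- x).
by rewrite subrr cexp0 x0 mul0r => /eqP; rewrite oner_eq0.
Qed.

Lemma cexp_mulz (R : realType) (x : R[i]) (n : int) :
  cexp (x * n%:~R) = cexp x ^ n.
Proof.
have natE m : cexp (x * m%:R) = cexp x ^+ m.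
  by elim: m => [|m IH]; rewrite ?mulr0 ?cexp0 // exprS -IH -cexpD mulrS mulrDr mulr1.
case: n => [|n]; first exact: natE.
apply: (mulIf (cexp_neq0 (x * n.+1%:R))).
rewrite -cexpD NegzE mulrNz mulrN addNr cexp0 natE.
by rewrite -[_ ^ _]/((cexp x ^+ n.+1)^-1) mulVf // expf_neq0 // cexp_neq0.
Qed.

(** * Support and weights of the R-matrix *)

Section Rmatrix.
Variables (R : realType) (hbar : R[i]).
Hypothesis q_not_root :
  forall n : nat, (0 < n)%N -> ~~ n.-unity_root (cexp hbar).
Local Notation q := (cexp hbar).
Local Notation V := (inv_qpoch q).

Lemma hbar_neq0 : hbar != 0.
Proof.
apply/eqP => h0; have := q_not_root (ltn0Sn 0).
by rewrite h0 cexp0 unity_rootE expr1 eqxx.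
Qed.

Lemma Rmat_neq0 (l1 l2 l3 : R[i]) (a1 a2 a3 b1 b2 b3 : int) :
  Rmat hbar l1 l2 l3 a1 a2 a3 b1 b2 b3 != 0 ->
  [/\ a1 + a2 = b1 + b2, a2 + a3 = b2 + b3 & b3 <= a2].
Proof.
rewrite /Rmat.
have [e1|_] := eqVneq (a1 + a2) (b1 + b2); last by rewrite mulr0 mul0r eqxx.
have [e2|_] := eqVneq (a2 + a3) (b2 + b3); last by rewrite mulr0 eqxx.
have [b3_le|a2_lt] := leP b3 a2; first by split.
by rewrite qpochV_neg ?mulr0 ?mul0r ?eqxx ?expf_neq0 ?cexp_neq0 // subr_lt0.
Qed.

(** The products [n13 * n23] cancel, which leaves an integer power of [q] and an exponential linear
    in the spectral parameters. *)
Lemma RmatE (l1 l2 l3 : R[i]) (a1 a2 a3 b1 b2 b3 : int) :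
  a1 + a2 = b1 + b2 -> a2 + a3 = b2 + b3 ->
  Rmat hbar l1 l2 l3 a1 a2 a3 b1 b2 b3 =
  (- q) ^ (a2 - b3) * q ^ ((b1 - b3) * (a2 - b3)) * V (a2 - b3) *
  cexp (l1 * (a2 - b3)%:~R + l2 * (b3 - b1)%:~R + l3 * (b1 - a2)%:~R).
Proof.
move=> e1 e2; rewrite /Rmat e1 e2 !eqxx !mulr1.
set x := hbar * _.
have -> : x = hbar * ((b1 - b3) * (a2 - b3))%:~R +
  (l1 * (a2 - b3)%:~R + l2 * (b3 - b1)%:~R + l3 * (b1 - a2)%:~R).
  by rewrite /x; field; exact: hbar_neq0.
by rewrite cexpD cexp_mulz /inv_qpoch; ring.
Qed.

Lemma merge_weights (m1 m2 m3 m4 e1 e2 e3 e4 : int)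
    (v1 v2 v3 v4 x1 x2 x3 x4 : R[i]) :
  ((- q) ^ m1 * q ^ e1 * v1 * cexp x1) * ((- q) ^ m2 * q ^ e2 * v2 * cexp x2) *
  ((- q) ^ m3 * q ^ e3 * v3 * cexp x3) * ((- q) ^ m4 * q ^ e4 * v4 * cexp x4) =
  (- q) ^ (m1 + m2 + m3 + m4) * q ^ (e1 + e2 + e3 + e4) *
  cexp (x1 + x2 + x3 + x4) * (v1 * v2 * v3 * v4).
Proof.
have q0 := cexp_neq0 hbar; have nq0 : - q != 0 by rewrite oppr_eq0.
by rewrite !(cexpD, expfzDr); [ring|..].
Qed.

End Rmatrix.

(** Turns a sum over all of Z^6 into one over a single index; [f] may vanish at some [g n], so [K]
    need only be an upper bound. *)
Lemma fsbig_parametrized (T : choiceType) (M : nmodType) (f : T -> M)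
    (g : nat -> T) (K : nat) :
  injective g -> (forall b, f b != 0 -> exists2 n, (n < K)%N & b = g n) ->
  finite_set [set b | f b != 0] /\
  \sum_(b \in [set: T]) f b = \sum_(n < K) f (g n).
Proof.
move=> g_inj supp; split.
  apply: (@sub_finite_set _ _ [set` [seq g n | n <- iota 0 K]]).
    move=> b /= /supp [n n_lt ->].
    by apply: map_f; rewrite mem_iota.
  exact: finite_seq.
rewrite (@fsbigE _ _ _ _ _ [seq g n | n <- iota 0 K]) //.
- rewrite big_map -[K in iota 0 K]subn0 -/(index_iota 0 K) big_mkord.
  by apply: eq_bigl => n; rewrite in_setT.
- by rewrite map_inj_uniq // iota_uniq.
- move=> b _ /negP b_notin; apply/eqP; apply: contra_notT b_notin => /supp [n n_lt ->].
  by apply: map_f; rewrite mem_iota.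
Qed.

Lemma mulf4_neq0 (F : fieldType) (x y z t : F) :
  x * y * z * t != 0 -> [/\ x != 0, y != 0, z != 0 & t != 0].
Proof. by rewrite !mulf_eq0 !negb_or => /andP[/andP[/andP[]]]. Qed.

Theorem theorem6p2 (R : realType) (hbar : R[i])
    (q_not_unity_root :
       forall n : nat, (0 < n)%N -> ~~ n.-unity_root (cexp hbar))
    (l1 l2 l3 l4 l5 l6 : R[i])
    (a1 a2 a3 a4 a5 a6 c1 c2 c3 c4 c5 c6 : int) :
  let lhs (b : int * int * int * int * int * int) : R[i] :=
    let: (b1, b2, b3, b4, b5, b6) := b in
    Rmat hbar l1 l2 l4 a1 a2 a4 b1 b2 b4 *
    Rmat hbar l1 l3 l5 b1 a3 a5 c1 b3 b5 *
    Rmat hbar l2 l3 l6 b2 b3 a6 c2 c3 b6 *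
    Rmat hbar l4 l5 l6 b4 b5 b6 c4 c5 c6 in
  let rhs (b : int * int * int * int * int * int) : R[i] :=
    let: (b1, b2, b3, b4, b5, b6) := b in
    Rmat hbar l4 l5 l6 a4 a5 a6 b4 b5 b6 *
    Rmat hbar l2 l3 l6 a2 a3 b6 b2 b3 c6 *
    Rmat hbar l1 l3 l5 a1 b3 b5 b1 c3 c5 *
    Rmat hbar l1 l2 l4 b1 b2 b4 c1 c2 c4 in
  [/\ finite_set [set b | lhs b != 0],
      finite_set [set b | rhs b != 0] &
      \sum_(b \in [set: int * int * int * int * int * int]) lhs b =
      \sum_(b \in [set: int * int * int * int * int * int]) rhs b].
Proof.
move=> lhs rhs.
set q := cexp hbar; have q0 : q != 0 := cexp_neq0 hbar.
(* The Pochhammer indices are [n], [N - n], [M], [n + g] on the left and [M - N + j], [N + g],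
   [N - j], [j] on the right. *)
pose N := c2 + c3 - a4 - a5; pose M := c3 - a6; pose g := a4 + c5 - a6 - c2.
(* The deltas determine all [b] from [n = b2 - a4] on the left and from [j = b2 - c4] on the
   right. *)
pose s (n : nat) := (a1 + a2 - a4 - n%:Z, a4 + n%:Z, c2 + c3 - a4 - n%:Z,
  a2 - n%:Z, a3 + a5 + a4 + n%:Z - c2 - c3, a6 + c2 - a4 - n%:Z).
pose t (j : nat) := (c1 + c2 - c4 - j%:Z, c4 + j%:Z, a2 + a3 - c4 - j%:Z,
  c2 - j%:Z, c3 + c5 + c4 + j%:Z - a2 - a3, c6 + a2 - c4 - j%:Z).
(* Compatibility conditions left after eliminating the [b] from the eight deltas. *)
pose conserved := [/\ c1 + c2 + c3 = a1 + a2 + a3,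
  c2 + c3 + c4 + c5 = a2 + a3 + a4 + a5 & c3 + c5 + c6 = a3 + a5 + a6].
have lhs_supp b : lhs b != 0 -> conserved /\
    exists2 n : nat, (n < `|N|%N.+1)%N & b = s n.
  case: b => [[[[[b1 b2] b3] b4] b5] b6]; rewrite /lhs.
  move=> /mulf4_neq0[/Rmat_neq0[? ? ?] /Rmat_neq0[? ? ?]].
  move=> /Rmat_neq0[? ? ?] /Rmat_neq0[? ? ?]; split; first by split; lia.
  (* On the support [n] and [N - n] are nonnegative, hence [n <= N]. *)
  exists `|b2 - a4|%N; first by rewrite /N; lia.
  by rewrite /s; congr (_, _, _, _, _, _); lia.
have rhs_supp b : rhs b != 0 -> conserved /\
    exists2 n : nat, (n < `|N|%N.+1)%N & b = t n.
  case: b => [[[[[b1 b2] b3] b4] b5] b6]; rewrite /rhs.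
  move=> /mulf4_neq0[/Rmat_neq0[? ? ?] /Rmat_neq0[? ? ?]].
  move=> /Rmat_neq0[? ? ?] /Rmat_neq0[? ? ?]; split; first by split; lia.
  exists `|b2 - c4|%N; first by rewrite /N; lia.
  by rewrite /t; congr (_, _, _, _, _, _); lia.
have s_inj : injective s by move=> n m [] *; lia.
have t_inj : injective t by move=> n m [] *; lia.
have [cons|ncons] := pselect conserved; last first.
  (* Without conservation both supports are empty, so the range [0] suffices. *)
  have [|? ->] := @fsbig_parametrized _ _ lhs s 0 s_inj.
    by move=> b /lhs_supp[].
  have [|? ->] := @fsbig_parametrized _ _ rhs t 0 t_inj.
    by move=> b /rhs_supp[].
  by split=> //; rewrite !big_ord0.
have [|? ->] := @fsbig_parametrized _ _ lhs s `|N|%N.+1 s_inj.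
  by move=> b /lhs_supp[].
have [|? ->] := @fsbig_parametrized _ _ rhs t `|N|%N.+1 t_inj.
  by move=> b /rhs_supp[].
split=> //.
(* [E] is the exponent of [q] outside the powers of [- q] at [n = 0], equal to that at [j = 0]; [X]
   is the spectral exponent shared by all terms of both sides. *)
pose E := (a1 + a2 - a4 - a5) * N + (a4 - a6) * M + (c4 - c6) * g.
pose X := l1 * (a2 + a3 - c4 - c5)%:~R + l2 * (a4 + c3 - a1 - a6)%:~R +
  l3 * (c5 + c6 - c1 - c2)%:~R + l4 * (a1 + a3 + a5 - c2 - c3 - c6)%:~R +
  l5 * (c1 + c6 - a3 - c4)%:~R + l6 * (c2 + c4 - a3 - a5)%:~R.
pose C := (- q) ^ (N + M + g) * q ^ E * cexp X.
have factor (n : nat) (e : int) (w : R[i]) :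
    (- q) ^ (N + M + g + n%:Z) * q ^ (E + e) * cexp X * w =
    C * ((- q) ^+ n * q ^ e * w).
  rewrite /C (expfzDr E) // [(- q) ^ _](@expfzDr _ _ _ n) ?oppr_eq0 // exprnP.
  by move: (_ ^ n%:Z) (_ ^ e) (_ ^ E) (_ ^ (N + M + g)) (cexp X) => *; ring.
case: cons => e1 e2 e3.
have {}e1 : c1 = a1 + a2 + a3 - c2 - c3 by lia.
have {}e2 : c4 = a2 + a3 + a4 + a5 - c2 - c3 - c5 by lia.
have {}e3 : c6 = a3 + a5 + a6 - c3 - c5 by lia.
have term_lhs (n : nat) : lhs (s n) = C * ((- q) ^+ n *
    q ^ (n%:Z * (n%:Z + 2 * (M - N))) *
    (inv_qpoch q n%:Z * inv_qpoch q (N - n%:Z) * inv_qpoch q M *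
     inv_qpoch q (n%:Z + g))).
  rewrite /lhs /s !RmatE //; try lia.
  rewrite merge_weights -factor.
  by congr (_ ^ _ * _ ^ _ * cexp _ *
      (inv_qpoch q _ * inv_qpoch q _ * inv_qpoch q _ * inv_qpoch q _));
    rewrite /X /E /N /M /g ?e1 ?e2 ?e3; ring.
have term_rhs (j : nat) : rhs (t j) = C * ((- q) ^+ j *
    q ^ (j%:Z * (j%:Z + 2 * g)) *
    (inv_qpoch q (M - N + j%:Z) * inv_qpoch q (N + g) *
     inv_qpoch q (N - j%:Z) * inv_qpoch q j%:Z)).
  rewrite /rhs /t !RmatE //; try lia.
  rewrite merge_weights -factor.
  by congr (_ ^ _ * _ ^ _ * cexp _ *
      (inv_qpoch q _ * inv_qpoch q _ * inv_qpoch q _ * inv_qpoch q _));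
    rewrite /X /E /N /M /g ?e1 ?e2 ?e3; ring.
under eq_bigr => n _ do rewrite term_lhs.
under [RHS]eq_bigr => n _ do rewrite term_rhs.
rewrite -!mulr_sumr tetrahedron_sum //; lia.
Qed.
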